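(* Let $m\ge 1$ be an integer and let $n\ge 1$ be an odd integer. Let $T=\sum_{j=1}^{n+1}t_j\,\partial_{y_j}$ be the unit tangent vector field on $S^n\subset\mathbb{R}^{n+1}$ with $t_j=-y_{j+1}$ for $j$ odd and $t_j=y_{j-1}$ for $j$ even. Let $M_1,\dots,M_{m+1}$ and $N_1,\dots,N_{n+1}$ be the meridian vector fields on $S^m$ and $S^n$ respectively. Then the product $S^m\times S^n$ is parallelized by the frame $\mathcal{P}=\{p_1,\dots,p_{m+n}\}$ given at $(x,y)\in S^m\times S^n$ by \[ p_i = M_i+x_iT,\qquad i=1,\dots,m-1, \] \[ p_{m-1+j} = y_j M_{m}+t_j M_{m+1}+(t_j x_{m+1}+y_j x_{m}-t_j)\,T+N_j,\qquad j=1,\dots,n+1. \] Moreover, $\mathcal{P}$ is orthonormal with respect to the standard product metric on $S^m\times S^n$.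
   Context: $S^m=\{x\in\mathbb{R}^{m+1}: |x|=1\}$ with coordinates $x=(x_1,\dots,x_{m+1})$, and $S^n=\{y\in\mathbb{R}^{n+1}: |y|=1\}$ with coordinates $y=(y_1,\dots,y_{n+1})$. The unit normal vector fields are $M=\sum_{i=1}^{m+1}x_i\partial_{x_i}$ on $S^m$ and $N=\sum_{j=1}^{n+1}y_j\partial_{y_j}$ on $S^n$. The $i$-th meridian vector field $M_i$ on $S^m$ ($i=1,\dots,m+1$) is the orthogonal projection of the coordinate field $\partial_{x_i}$ onto the tangent spaces of $S^m$, i.e. $M_i=\partial_{x_i}-x_iM$; likewise $N_j=\partial_{y_j}-y_jN$ ($j=1,\dots,n+1$) is the $j$-th meridian vector field on $S^n$. Vector fields on the factors are regarded as vector fields on $S^m\times S^n$ via $T_{(x,y)}(S^m\times S^n)=T_xS^m\oplus T_yS^n\subset\mathbb{R}^{m+1}\oplus\mathbb{R}^{n+1}$. The standard product metric is the one induced from the Euclidean metric of $\mathbb{R}^{m+1}\oplus\mathbb{R}^{n+1}$. A manifold is parallelized by a frame if the frame consists of smooth global vector fields forming a basis of the tangent space at every point. *)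

(* Defs.v *)
From HB Require Import structures.
From mathcomp Require Import all_boot all_order all_algebra.
From mathcomp Require Import all_classical all_reals all_analysis.

Set Implicit Arguments.
Unset Strict Implicit.
Unset Printing Implicit Defensive.

Import Order.TTheory GRing.Theory Num.Theory.
Import numFieldNormedType.Exports.

Local Open Scope classical_set_scope.
Local Open Scope ring_scope.

Section Smoothness.
Variables (R : realType) (V W : normedModType R).

(* For finite-dimensional V, f is C^(k+1) on the open set U iff it is
   differentiable on U and p |-> 'd f p v is C^k on U for every fixed v. *)
Fixpoint class_C (k : nat) (U : set V) (f : V -> W) : Prop :=
  match k with
  | 0 => forall p, U p -> {for p, continuous f}
  | k'.+1 => (forall p, U p -> differentiable f p) /\
             forall v : V, class_C k' U (fun p => 'd f p v)
  end.

Definition smooth_on_open (U : set V) (f : V -> W) : Prop :=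
  forall k, class_C k U f.

(* Smoothness of a map on a subset A of V, e.g. an embedded submanifold:
   locally, f is the restriction to A of a smooth map on an open set. *)
Definition smooth_on (A : set V) (f : V -> W) : Prop :=
  forall p, A p -> exists (U : set V) (g : V -> W),
    [/\ open U, U p, smooth_on_open U g & forall q, (A `&` U) q -> f q = g q].

End Smoothness.

Section Euclidean.
Variable R : realType.

Definition dot k (u v : 'rV[R]_k) : R := \sum_(i < k) u 0 i * v 0 i.

(* The library's norm on 'rV[R]_k is the sup norm, hence this one. *)
Definition enorm k (u : 'rV[R]_k) : R := Num.sqrt (dot u u).

(* Coordinates are numbered from 1: [coord1 x i] is x_i for 1 <= i <= k + 1
   (indices outside this range are never used), and [partial i] is the
   coordinate field d/dx_i. *)
Definition coord1 k (x : 'rV[R]_k.+1) (i : nat) : R := x 0 (inord i.-1).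
Definition partial k (i : nat) : 'rV[R]_k.+1 := delta_mx 0 (inord i.-1).

(* sphere k is S^k in R^(k+1). *)
Definition sphere k : set 'rV[R]_k.+1 := [set x | enorm x = 1].

Definition normal_field k (x : 'rV[R]_k.+1) : 'rV[R]_k.+1 :=
  \sum_(1 <= i < k.+2) coord1 x i *: partial k i.

Definition meridian k (i : nat) (x : 'rV[R]_k.+1) : 'rV[R]_k.+1 :=
  partial k i - coord1 x i *: normal_field x.

Definition hopf_coef k (y : 'rV[R]_k.+1) (j : nat) : R :=
  if odd j then - coord1 y j.+1 else coord1 y j.-1.

Definition hopf_field k (y : 'rV[R]_k.+1) : 'rV[R]_k.+1 :=
  \sum_(1 <= j < k.+2) hopf_coef y j *: partial k j.

(* T_x S^k, the orthogonal complement of the normal x: see sphere_tangentP. *)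
Definition sphere_tangent k (x : 'rV[R]_k.+1) : {vspace 'rV[R]_k.+1} :=
  lker (linfun (mulmxr (normal_field x)^T : 'rV[R]_k.+1 -> 'rV[R]_1)).

Lemma normal_fieldE k (x : 'rV[R]_k.+1) : normal_field x = x.
Proof.
rewrite /normal_field big_add1 big_mkord [RHS]row_sum_delta.
by apply: eq_bigr => i _; rewrite /coord1 /partial /= inord_val.
Qed.

Lemma sphere_tangentP k (x v : 'rV[R]_k.+1) :
  (v \in sphere_tangent x) = (dot v x == 0).
Proof.
rewrite memv_ker lfunE /= normal_fieldE; apply/eqP/eqP => [/rowP/(_ 0)|h].
  by rewrite !mxE => h; rewrite -[RHS]h; apply: eq_bigr => i _; rewrite mxE.
apply/rowP => i; rewrite ord1 !mxE -[RHS]h.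
by apply: eq_bigr => j _; rewrite mxE.
Qed.

End Euclidean.

(* R^(m+1) (+) R^(n+1), as the library's product normed module. *)
Notation ambient R m n := ('rV[R]_m.+1 * 'rV[R]_n.+1)%type.

Section Product.
Variables (R : realType) (m n : nat).
Local Notation E := (ambient R m n).

Definition inner (u v : E) : R := dot u.1 v.1 + dot u.2 v.2.

Definition sphere_prod : set E := @sphere R m `*` @sphere R n.

(* T_x S^m (+) T_y S^n at z = (x, y). *)
Definition prod_tangent (z : E) : {vspace E} :=
  (linfun (fst : E -> 'rV[R]_m.+1) @^-1: sphere_tangent z.1 :&:
   linfun (snd : E -> 'rV[R]_n.+1) @^-1: sphere_tangent z.2)%VS.

Lemma prod_tangentP (z u : E) :
  (u \in prod_tangent z) =
  (u.1 \in sphere_tangent z.1) && (u.2 \in sphere_tangent z.2).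
Proof. by rewrite memv_cap -!memv_preim !lfunE. Qed.

Definition smooth_vector_field (X : E -> E) : Prop :=
  smooth_on sphere_prod X /\ forall z, sphere_prod z -> X z \in prod_tangent z.

Definition parallelized_by k (P : 'I_k -> E -> E) : Prop :=
  (forall i, smooth_vector_field (P i)) /\
  forall z, sphere_prod z -> basis_of (prod_tangent z) [seq P i z | i : 'I_k].

Definition orthonormal_frame k (P : 'I_k -> E -> E) : Prop :=
  forall z, sphere_prod z ->
    forall i j, inner (P i z) (P j z) = (i == j)%:R.

(* Vectors of the factors seen as vectors of the product. *)
Definition from_left (v : 'rV[R]_m.+1) : E := (v, 0).
Definition from_right (w : 'rV[R]_n.+1) : E := (0, w).

Definition p_head (i : nat) (z : E) : E :=
  let: (x, y) := z in
  from_left (meridian i x) + coord1 x i *: from_right (hopf_field y).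

Definition p_tail (j : nat) (z : E) : E :=
  let: (x, y) := z in
  let y_j := coord1 y j in
  let t_j := hopf_coef y j in
  y_j *: from_left (meridian m x) + t_j *: from_left (meridian m.+1 x)
  + (t_j * coord1 x m.+1 + y_j * coord1 x m - t_j)
      *: from_right (hopf_field y)
  + from_right (meridian j y).

(* p_1, ..., p_(m+n), indexed from 1: p_i is [p_head i] for 1 <= i <= m - 1,
   and p_(m-1+j) is [p_tail j] for 1 <= j <= n + 1. *)
Definition frame_field (i : nat) : E -> E :=
  if (i <= m.-1)%N then p_head i else p_tail (i - m.-1)%N.

Definition frame (k : 'I_(m + n)) : E -> E := frame_field k.+1.

End Product.

(* Main.v *)
From HB Require Import structures.
Require Import Defs.
From mathcomp Require Import all_boot all_order all_algebra.
From mathcomp Require Import all_classical all_reals all_analysis.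
From mathcomp Require Import ring lra zify.

(** Why the frame is orthonormal.  The vectors M_i have Gram matrix
    (i == k) - x_i x_k, and each p_i with i < m carries a component x_i T along
    the unit field T of the other factor: the term x_i x_k coming from T
    exactly repairs the defect of the meridians, so the first m - 1 fields are
    orthonormal.  For the remaining fields write a_j = y_j x_m + t_j x_(m+1).
    The S^m-parts y_j M_m + t_j M_(m+1) have Gram matrix
    y_j y_k + t_j t_k - a_j a_k.  The S^n-parts are (a_j - t_j) T + N_j, and
    since <T, N_j> = t_j and <N_j, N_k> = (j == k) - y_j y_k, their Gram matrix
    is a_j a_k - t_j t_k + (j == k) - y_j y_k.  The two add up to (j == k)
    ([inner_tail_tail]).  The mixed products vanish in the same way
    ([inner_head_tail]).  Three facts on T are used: it is orthogonal to y, it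
    has the norm of y, and its j-th coordinate is t_j.  The first two hold
    because T is y with its coordinates swapped in pairs, one sign of each pair
    being reversed; the pairing exists as n + 1 is even ([hopf_swap]).

    Why it is a basis.  The m + n orthonormal fields are free, and they are
    tangent because meridians and T are.  As (x, 0) and (0, y) are orthonormal
    and orthogonal to the tangent space, the latter has dimension at most
    (m + 1) + (n + 1) - 2 = m + n ([dim_prod_tangent]), which is the number of
    fields.

    Why it is smooth.  The formulas make sense on the whole ambient space and
    are polynomial in the coordinates.  The class C^k is stable under sums,
    pairing and scalar multiplication, and contains constants and continuous
    linear maps, so each field is the restriction of a smooth map. *)

Set Implicit Arguments.
Unset Strict Implicit.
Unset Printing Implicit Defensive.

Import Order.TTheory GRing.Theory Num.Theory.
Import numFieldNormedType.Exports.

Local Open Scope classical_set_scope.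
Local Open Scope ring_scope.

(** * Calculus of C^k maps *)

Section SmoothCalculus.
Variables (R : realType) (V : normedModType R).

Lemma class_C_le (W : normedModType R) k (U : set V) (f : V -> W) :
  class_C k.+1 U f -> class_C k U f.
Proof.
elim: k f => [f [df _] p Up|k IH f [df ddf]].
  exact/differentiable_continuous/df.
by split=> // v; apply/IH/ddf.
Qed.

Lemma class_C_cst (W : normedModType R) k (U : set V) (w : W) :
  class_C k U (fun _ : V => w).
Proof.
elim: k w => [|k IH] w /=; first by move=> p _; exact: cst_continuous.
split=> [p _|v]; first exact: differentiable_cst.
suff -> : (fun p => 'd (fun _ : V => w) p v) = fun=> 0 by exact: IH.
by apply/funext => p; rewrite (diff_cst w).
Qed.

Lemma class_C_id k : class_C k setT (@id V).
Proof.
elim: k => [p _|k IH] /=; first exact: id.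
split=> [p _|v]; first by have [] := is_diff_id p.
suff -> : (fun p => 'd (@id V) p v) = fun=> v by exact: class_C_cst.
by apply/funext => p; rewrite diff_val.
Qed.

Lemma class_C_lin_comp (W W' : normedModType R) (L : W -> W') k (f : V -> W) :
  linear L -> continuous L ->
  class_C k setT f -> class_C k setT (fun p => L (f p)).
Proof.
move=> linL cL.
pose lL : {linear W -> W'} := HB.pack L (GRing.isLinear.Build _ _ _ _ L linL).
have dL q : differentiable L q by exact: (@linear_differentiable _ _ _ lL).
elim: k f => [f cf p pT|k IH f [df ddf]] /=.
  by apply: continuous_comp; [exact: cf|exact: cL].
split=> [p pT|v]; first exact: (differentiable_comp (df p pT)).
suff -> : (fun p => 'd (fun q => L (f q)) p v) = fun p => L ('d f p v).
  exact/IH/ddf.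
apply/funext => p.
rewrite -[X in 'd X p]/(L \o f) diff_comp //; last exact: df.
by have /= -> := @diff_lin _ _ _ lL (f p) cL.
Qed.

Lemma class_CD (W : normedModType R) k (f g : V -> W) :
  class_C k setT f -> class_C k setT g -> class_C k setT (fun p => f p + g p).
Proof.
elim: k f g => [f g cf cg p pT|k IH f g [df ddf] [dg ddg]] /=.
  by apply: continuousD; [exact: cf|exact: cg].
split=> [p pT|v]; first by apply: differentiableD; [exact: df|exact: dg].
suff -> : (fun p => 'd (fun q => f q + g q) p v)
          = fun p => 'd f p v + 'd g p v.
  by apply: IH; [exact: ddf|exact: ddg].
apply/funext => p.
by rewrite -[X in 'd X p]/(f + g) diffD //; [exact: df|exact: dg].
Qed.

Lemma class_C_sum (W : normedModType R) k (I : Type) (r : seq I)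
  (f : I -> V -> W) : (forall i, class_C k setT (f i)) ->
  class_C k setT (fun p => \sum_(i <- r) f i p).
Proof.
move=> Cf; elim: r => [|i r IH].
  by under eq_fun do rewrite big_nil; exact: class_C_cst.
by under eq_fun do rewrite big_cons; exact: class_CD.
Qed.

Lemma class_C_pair (W W' : normedModType R) k (f : V -> W) (g : V -> W') :
  class_C k setT f -> class_C k setT g ->
  class_C k setT (fun p => (f p, g p)).
Proof.
elim: k f g => [f g cf cg p pT|k IH f g [df ddf] [dg ddg]] /=.
  by apply: cvg_pair; [exact: cf|exact: cg].
split=> [p pT|v]; first by apply: differentiable_pair; [exact: df|exact: dg].
suff -> : (fun p => 'd (fun q => (f q, g q)) p v)
          = fun p => ('d f p v, 'd g p v).
  by apply: IH; [exact: ddf|exact: ddg].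
by apply/funext => p; rewrite diff_pair; [| exact: df | exact: dg].
Qed.

(** Induction on k by the Leibniz rule, read off from the differential of the
    bilinear map (a, w) |-> a *: w; the two terms of the rule involve f and g
    themselves, whence the use of [class_C_le]. *)
Lemma class_CZ (W : normedModType R) k (f : V -> R) (g : V -> W) :
  class_C k setT f -> class_C k setT g -> class_C k setT (fun p => f p *: g p).
Proof.
have b_bilin : bilinear_for
    (GRing.Scale.Law.clone _ _ *:%R _) (GRing.Scale.Law.clone _ _ *:%R _)
    (@GRing.scale R W).
  by split=> [w|a] c x y /=; rewrite (scalerDl, scalerDr) !scalerA // mulrC.
pose bM := bilinear_isBilinear.Build R R W W _ _ (@GRing.scale R W) b_bilin.
pose b : {bilinear R -> W -> W} := HB.pack (@GRing.scale R W) bM.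
have cb : continuous (fun q : R * W => b q.1 q.2) by exact: scale_continuous.
elim: k f g => [f g cf cg p pT|k IH f g Cf Cg].
  by apply: continuousZ; [exact: cf|exact: cg].
have [[df ddf] [dg ddg]] := (Cf, Cg).
have dfg p : differentiable (fun q => (f q, g q)) p.
  by apply: differentiable_pair; [exact: df|exact: dg].
split=> [p pT|v].
  exact: (differentiable_comp (dfg p) (differentiable_bilin (f p, g p) cb)).
suff -> : (fun p => 'd (fun q => f q *: g q) p v)
          = fun p => f p *: 'd g p v + 'd f p v *: g p.
  by apply: class_CD; apply: IH;
    by [exact: ddf|exact: ddg|exact: class_C_le Cf|exact: class_C_le Cg].
apply/funext => p.
pose B (q : R * W) := b q.1 q.2.
rewrite -[X in 'd X p]/(B \o (fun q => (f q, g q))).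
rewrite diff_comp //; last exact: differentiable_bilin.
have /= -> := diff_bilin (f p, g p) cb.
by rewrite diff_pair //; [exact: df|exact: dg].
Qed.

Lemma class_C_coord1 k l i (f : V -> 'rV[R]_l.+1) :
  class_C k setT f -> class_C k setT (fun p => coord1 (f p) i).
Proof.
apply: (class_C_lin_comp (L := fun x : 'rV[R]_l.+1 => coord1 x i)).
  by move=> a u v; rewrite /coord1 !mxE.
exact: coord_continuous.
Qed.

Lemma class_C_hopf_coef k l j (f : V -> 'rV[R]_l.+1) :
  class_C k setT f -> class_C k setT (fun p => hopf_coef (f p) j).
Proof.
move=> Cf; rewrite /hopf_coef; case: odd; last exact: class_C_coord1.
under eq_fun do rewrite -mulN1r.
by apply: class_CZ; [exact: class_C_cst|exact: class_C_coord1].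
Qed.

Lemma class_C_hopf_field k l (f : V -> 'rV[R]_l.+1) :
  class_C k setT f -> class_C k setT (fun p => hopf_field (f p)).
Proof.
move=> Cf; apply: class_C_sum => j; apply: class_CZ; last exact: class_C_cst.
exact: class_C_hopf_coef.
Qed.

Lemma class_C_meridian k l i (f : V -> 'rV[R]_l.+1) :
  class_C k setT f -> class_C k setT (fun p => meridian i (f p)).
Proof.
move=> Cf; under eq_fun do rewrite /meridian normal_fieldE -scaleNr -mulN1r.
apply: class_CD; first exact: class_C_cst.
apply: class_CZ => //; apply: class_CZ; first exact: class_C_cst.
exact: class_C_coord1.
Qed.

End SmoothCalculus.

(** * Smoothness of the frame *)

Section FrameSmooth.
Variables (R : realType) (m n : nat).
Local Notation E := (ambient R m n).

Lemma class_C_fst k : class_C k setT (fst : E -> _).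
Proof.
apply: (class_C_lin_comp (L := fst) (f := id)) => //; last exact: class_C_id.
by move=> z; exact: cvg_fst.
Qed.

Lemma class_C_snd k : class_C k setT (snd : E -> _).
Proof.
apply: (class_C_lin_comp (L := snd) (f := id)) => //; last exact: class_C_id.
by move=> z; exact: cvg_snd.
Qed.

Lemma class_C_from_left (V : normedModType R) k (f : V -> 'rV[R]_m.+1) :
  class_C k setT f -> class_C k setT (fun p => from_left n (f p)).
Proof. by move=> Cf; apply: class_C_pair => //; exact: class_C_cst. Qed.

Lemma class_C_from_right (V : normedModType R) k (f : V -> 'rV[R]_n.+1) :
  class_C k setT f -> class_C k setT (fun p => from_right m (f p)).
Proof. by move=> Cf; apply: class_C_pair => //; exact: class_C_cst. Qed.

Lemma class_C_frame k (i : 'I_(m + n)) :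
  class_C k setT (@frame R m n i).
Proof.
have Cx := class_C_fst k; have Cy := class_C_snd k.
(* In this form the match on the point z reduces. *)
have -> : frame i = fun z : E => frame i (z.1, z.2).
  by apply/funext => -[].
rewrite /frame /frame_field; case: ifP => _.
  apply: class_CD; first exact/class_C_from_left/class_C_meridian.
  apply: class_CZ; first exact: class_C_coord1.
  exact/class_C_from_right/class_C_hopf_field.
apply: class_CD; last exact/class_C_from_right/class_C_meridian.
apply: class_CD.
  apply: class_CD; apply: class_CZ;
    by [exact: class_C_coord1 | exact: class_C_hopf_coef |
        exact/class_C_from_left/class_C_meridian].
apply: class_CZ; last exact/class_C_from_right/class_C_hopf_field.
under eq_fun do rewrite -[X in _ - X]mul1r -mulNr.
apply: class_CD; [apply: class_CD; apply: class_CZ|apply: class_CZ];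
  by [exact: class_C_coord1 | exact: class_C_hopf_coef | exact: class_C_cst].
Qed.

Lemma smooth_on_frame (i : 'I_(m + n)) :
  smooth_on (@sphere_prod R m n) (frame i).
Proof.
move=> z _; exists setT, (frame i); split=> //; first exact: openT.
by move=> k; exact: class_C_frame.
Qed.

End FrameSmooth.

(** * Meridians and the field T on one sphere *)

Section Dot.
Variables (R : realType) (l : nat).
Implicit Types u v w x y : 'rV[R]_l.+1.

Lemma dotC u v : dot u v = dot v u.
Proof. by apply: eq_bigr => i _; rewrite mulrC. Qed.

Lemma dotDl u v w : dot (u + v) w = dot u w + dot v w.
Proof. by rewrite -big_split; apply: eq_bigr => i _; rewrite mxE mulrDl. Qed.

Lemma dotZl a u v : dot (a *: u) v = a * dot u v.
Proof. by rewrite mulr_sumr; apply: eq_bigr => i _; rewrite mxE mulrA. Qed.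

Lemma dotDr u v w : dot w (u + v) = dot w u + dot w v.
Proof. by rewrite !(dotC w) dotDl. Qed.

Lemma dotZr a u v : dot v (a *: u) = a * dot v u.
Proof. by rewrite !(dotC v) dotZl. Qed.

(** With [dotZl], [dotZr] and [dotZDr], this expands linear combinations of
    meridians and leaves the meridians folded, whereas [dotDl] also matches a
    meridian, which is a sum up to conversion. *)
Lemma dotZDl a u v w : dot (a *: u + v) w = a * dot u w + dot v w.
Proof. by rewrite dotDl dotZl. Qed.

Lemma dotZDr a u v w : dot w (a *: u + v) = a * dot w u + dot w v.
Proof. by rewrite dotDr dotZr. Qed.

Lemma dotNl u v : dot (- u) v = - dot u v.
Proof. by rewrite -scaleN1r dotZl mulN1r. Qed.

Lemma dotNr u v : dot v (- u) = - dot v u.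
Proof. by rewrite dotC dotNl dotC. Qed.

Lemma dot0l v : dot 0 v = 0.
Proof. by rewrite -(scale0r 0) dotZl mul0r. Qed.

Lemma dot_partial i v : dot (partial R l i) v = coord1 v i.
Proof.
rewrite /dot (bigD1 (inord i.-1)) //= mxE !eqxx mul1r big1 ?addr0 // => j ji.
by rewrite mxE (negbTE ji) andbF mul0r.
Qed.

Lemma coord1_partial i j : (0 < i < l.+2)%N -> (0 < j < l.+2)%N ->
  coord1 (partial R l i) j = (i == j)%:R.
Proof.
move=> /andP[i0 il] /andP[j0 jl]; rewrite /coord1 mxE eqxx /=; congr (_%:R).
case: i i0 il => // i _ il; case: j j0 jl => // j _ jl /=.
by rewrite -(inj_eq val_inj) /= !inordK // eq_sym eqSS.
Qed.

Lemma dot_sphere x : sphere x -> dot x x = 1.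
Proof.
move=> /= x1; have x0 : 0 <= dot x x.
  by apply: sumr_ge0 => i _; rewrite -expr2 sqr_ge0.
by rewrite -(sqr_sqrtr x0) -/(enorm x) x1 expr1n.
Qed.

Lemma meridianE i x : meridian i x = partial R l i - coord1 x i *: x.
Proof. by rewrite /meridian normal_fieldE. Qed.

Lemma dot_meridian_normal i x : sphere x -> dot (meridian i x) x = 0.
Proof.
by move=> /dot_sphere x1; rewrite meridianE dotDl dotNl dotZl x1 dot_partial;
  ring.
Qed.

Lemma dot_meridian i j x : sphere x ->
  (0 < i < l.+2)%N -> (0 < j < l.+2)%N ->
  dot (meridian i x) (meridian j x) = (i == j)%:R - coord1 x i * coord1 x j.
Proof.
move=> Sx il jl.
rewrite [meridian j x]meridianE dotDr dotNr dotZr dot_meridian_normal //.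
have -> : dot (meridian i x) (partial R l j)
        = coord1 (partial R l i) j - coord1 x i * coord1 x j.
  by rewrite dotC dot_partial meridianE /coord1 !mxE.
by rewrite coord1_partial //; ring.
Qed.

Lemma coord1_hopf_field y j : (0 < j < l.+2)%N ->
  coord1 (hopf_field y) j = hopf_coef y j.
Proof.
move=> jl; rewrite -dot_partial /hopf_field.
rewrite (big_morph (dot (partial R l j)) (fun u v => dotDr u v (partial R l j))
  (etrans (dotC (partial R l j) 0) (dot0l (partial R l j)))).
rewrite (bigD1_seq j) ?mem_index_iota ?iota_uniq //=.
rewrite dotZr dot_partial coord1_partial // eqxx mulr1 big1_seq ?addr0 //.
move=> i /andP[ij]; rewrite mem_index_iota => il.
by rewrite dotZr dot_partial coord1_partial // (negbTE ij) mulr0.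
Qed.

Hypothesis oddl : odd l.

(** With indices counted from 0, the coordinates 2i and 2i + 1 are exchanged;
    as l + 1 is even, the last index also has a partner. *)
Definition hopf_swap (i : 'I_l.+1) : 'I_l.+1 :=
  inord (if odd i then i.-1 else i.+1).

Lemma val_hopf_swap (i : 'I_l.+1) :
  hopf_swap i = (if odd i then i.-1 else i.+1) :> nat.
Proof.
rewrite /hopf_swap inordK //; case: i => i /=; rewrite ltnS leq_eqVlt.
case/predU1P => [->|il]; first by rewrite oddl; case: (l).
by case: ifP => _; [case: i il => //= i /ltnW /ltnW|].
Qed.

Lemma odd_hopf_swap i : odd (hopf_swap i) = ~~ odd i.
Proof.
rewrite val_hopf_swap; case: i => -[|i] _ //=.
by case: ifPn => /= [/negbTE|/negPn ->].
Qed.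

Lemma hopf_swapK : involutive hopf_swap.
Proof.
move=> i; apply: val_inj => /=; rewrite val_hopf_swap odd_hopf_swap.
by rewrite val_hopf_swap; case: i => -[|i] _ //=; case: odd.
Qed.

Lemma hopf_fieldE y i :
  hopf_field y 0 i = (if odd i then 1 else -1) * y 0 (hopf_swap i).
Proof.
have := coord1_hopf_field y (j := i.+1) (ltn_ord i).
rewrite /coord1 /= inord_val => ->; rewrite /hopf_coef /coord1 /hopf_swap /=.
by case: (odd i); rewrite /= ?mul1r ?mulN1r.
Qed.

(** Exchanging the two indices of each pair turns the sum into its opposite, because
    the two signs of a pair differ. *)
Lemma dot_hopf_normal y : dot (hopf_field y) y = 0.
Proof.
have e : dot (hopf_field y) y = - dot (hopf_field y) y.
  rewrite {1}/dot (reindex_inj (inv_inj hopf_swapK)) -sumrN /=.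
  apply: eq_bigr => i _; rewrite !hopf_fieldE odd_hopf_swap hopf_swapK.
  by case: odd => /=; ring.
lra.
Qed.

Lemma dot_hopf y : dot (hopf_field y) (hopf_field y) = dot y y.
Proof.
rewrite [RHS](reindex_inj (inv_inj hopf_swapK)) /=.
by apply: eq_bigr => i _; rewrite !hopf_fieldE; case: odd; ring.
Qed.

Lemma dot_hopf_meridian j y : (0 < j < l.+2)%N ->
  dot (hopf_field y) (meridian j y) = hopf_coef y j.
Proof.
move=> jl; rewrite meridianE dotDr dotNr dotZr dot_hopf_normal.
by rewrite dotC dot_partial coord1_hopf_field //; ring.
Qed.

End Dot.

(** * Orthonormality and dimension in the product *)

Section Inner.
Variables (R : realType) (m n : nat).
Local Notation E := (ambient R m n).
Implicit Types u v w : E.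

Lemma innerC u v : inner u v = inner v u.
Proof. by rewrite /inner !(dotC v.1) (dotC v.2). Qed.

Lemma innerDl u v w : inner (u + v) w = inner u w + inner v w.
Proof. by rewrite /inner !dotDl addrACA. Qed.

Lemma innerZl a u w : inner (a *: u) w = a * inner u w.
Proof. by rewrite /inner !dotZl mulrDr. Qed.

Lemma inner0l w : inner 0 w = 0.
Proof. by rewrite -(scale0r 0) innerZl mul0r. Qed.

Lemma inner_suml (I : finType) (f : I -> E) w :
  inner (\sum_i f i) w = \sum_i inner (f i) w.
Proof.
exact: (big_morph (fun u => inner u w) (fun u v => innerDl u v w) (inner0l w)).
Qed.

Lemma orthonormal_free k (f : 'I_k -> E) :
  (forall i j, inner (f i) (f j) = (i == j)%:R) -> free [seq f i | i : 'I_k].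
Proof.
move=> fo; pose X := [tuple f i | i < k].
have XE (i : 'I_k) : X`_i = f i by rewrite -tnth_nth tnth_mktuple.
suff: free X by [].
apply/freeP => a sa0 i; rewrite -(inner0l (f i)) -sa0 inner_suml.
rewrite (bigD1 i) //= XE innerZl fo eqxx mulr1 big1 ?addr0 // => j ji.
by rewrite XE innerZl fo (negbTE ji) mulr0.
Qed.

Lemma dim_add_normal (U : {vspace E}) w :
  inner w w = 1 -> (forall u, u \in U -> inner u w = 0) ->
  \dim (U + <[w]>) = (\dim U).+1.
Proof.
move=> w1 Uw; have w0 : w != 0.
  by apply/eqP => w0; move: w1; rewrite w0 inner0l => /esym/eqP; rewrite oner_eq0.
rewrite dimv_disjoint_sum ?dim_vline ?w0 ?addn1 //.
apply/eqP; rewrite -subv0; apply/subvP => u; rewrite memv_cap => /andP[uU].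
case/vlineP => a ua; move: (Uw _ uU); rewrite ua innerZl w1 mulr1 => ->.
by rewrite scale0r mem0v.
Qed.

(** The normals (x, 0) and (0, y) raise the dimension by two without leaving
    the ambient space of dimension m + n + 2. *)
Lemma dim_prod_tangent (z : E) : sphere_prod z ->
  (\dim (prod_tangent z) <= m + n)%N.
Proof.
case: z => x y [/= Sx Sy]; set T := prod_tangent _.
have T_orth u : u \in T -> dot u.1 x = 0 /\ dot u.2 y = 0.
  by rewrite prod_tangentP !sphere_tangentP => /andP[/eqP ? /eqP].
have dimTx : \dim (T + <[from_left n x]>) = (\dim T).+1.
  apply: dim_add_normal => [|u /T_orth[ux _]]; rewrite /inner /=.
    by rewrite dot0l dot_sphere ?addr0.
  by rewrite ux dotC dot0l addr0.
have dimTxy : \dim (T + <[from_left n x]> + <[from_right m y]>) = (\dim T).+2.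
  rewrite dim_add_normal ?dimTx // => [|u]; rewrite /inner /=.
    by rewrite dot0l dot_sphere ?add0r.
  case/memv_addP => t /T_orth[_ ty] [_ /vlineP[a ->] ->] /=.
  by rewrite dotC dot0l dotDl ty dotZl dot0l mulr0 !addr0.
suff : ((\dim T).+2 <= m.+1 + n.+1)%N by rewrite addSn addnS.
rewrite -dimTxy; apply: leq_trans (dimvS (subvf _)) _.
by rewrite dimvf /dim /= !dim_matrix !mul1r.
Qed.

End Inner.

(** * Gram matrix of the frame *)

Section Frame.
Variables (R : realType) (m n : nat).
Hypotheses (hm : (1 <= m)%N) (hn : odd n).
Local Notation E := (ambient R m n).
Variables (x : 'rV[R]_m.+1) (y : 'rV[R]_n.+1).
Hypotheses (Sx : sphere x) (Sy : sphere y).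

Let dotE := (dotZDl, dotZDr, dotZl, dotZr).

Lemma p_headE i :
  p_head i (x, y) = (meridian i x, coord1 x i *: hopf_field y) :> E.
Proof. by congr pair; rewrite /= ?scaler0 ?addr0 ?add0r. Qed.

Lemma p_tailE j :
  p_tail j (x, y) =
  (coord1 y j *: meridian m x + hopf_coef y j *: meridian m.+1 x,
   (hopf_coef y j * coord1 x m.+1 + coord1 y j * coord1 x m - hopf_coef y j)
     *: hopf_field y + meridian j y) :> E.
Proof. by congr pair; rewrite /= ?scaler0 ?addr0 ?add0r. Qed.

Lemma inner_head_head i j : (0 < i < m.+2)%N -> (0 < j < m.+2)%N ->
  inner (p_head i (x, y) : E) (p_head j (x, y)) = (i == j)%:R.
Proof.
move=> il jl; rewrite !p_headE /inner /= !dotE dot_hopf // dot_sphere //.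
by rewrite dot_meridian //; ring.
Qed.

(** The meridians contribute - x_i (y_j x_m + t_j x_(m+1)), since i < m; the
    field T contributes x_i (y_j x_m + t_j x_(m+1) - t_j) + x_i t_j. *)
Lemma inner_head_tail i j : (0 < i < m)%N -> (0 < j < n.+2)%N ->
  inner (p_head i (x, y) : E) (p_tail j (x, y)) = 0.
Proof.
move=> /andP[i0 im] jl; rewrite p_headE p_tailE /inner /= !dotE.
rewrite dot_hopf // dot_hopf_meridian // dot_sphere //.
rewrite !dot_meridian ?hm ?i0 //=; try lia.
rewrite (_ : (i == m) = false) 1?(_ : (i == m.+1) = false); try lia.
by rewrite /=; ring.
Qed.

Lemma inner_tail_tail j k : (0 < j < n.+2)%N -> (0 < k < n.+2)%N ->
  inner (p_tail j (x, y) : E) (p_tail k (x, y)) = (j == k)%:R.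
Proof.
move=> jl kl; rewrite !p_tailE /inner /= !dotE.
rewrite (dotC (meridian j y) (hopf_field y)).
rewrite dot_hopf // !dot_hopf_meridian // (dot_sphere Sy).
rewrite !dot_meridian ?hm //=; try lia.
rewrite !eqxx (_ : (m == m.+1) = false) 1?(_ : (m.+1 == m) = false); try lia.
by rewrite /=; ring.
Qed.

Lemma inner_frame (i j : 'I_(m + n)) :
  inner (frame i (x, y)) (frame j (x, y)) = (i == j)%:R.
Proof.
have := (ltn_ord i, ltn_ord j); case=> ilt jlt.
rewrite -(inj_eq val_inj) /= /frame /frame_field.
case: ifPn => ile; case: ifPn => jle.
- by rewrite inner_head_head ?eqSS //; lia.
- rewrite inner_head_tail; try lia.
  by case: eqP => // ij; move: ile jle; rewrite ij => ->.
- rewrite innerC inner_head_tail; try lia.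
  by case: eqP => // ij; move: ile jle; rewrite ij => /negbTE ->.
- rewrite inner_tail_tail; try lia.
  by congr (_%:R : R); congr nat_of_bool; apply/eqP/eqP; lia.
Qed.

Lemma frame_tangent (i : 'I_(m + n)) :
  frame i (x, y) \in prod_tangent (x, y : 'rV[R]_n.+1).
Proof.
rewrite prod_tangentP !sphere_tangentP /frame /frame_field.
case: ifP => _; rewrite (p_headE, p_tailE) /= !dotE.
  by rewrite dot_meridian_normal // dot_hopf_normal // mulr0 eqxx.
by rewrite !dot_meridian_normal // dot_hopf_normal // !mulr0 addr0 eqxx.
Qed.

End Frame.

Theorem theorem5p1 (R : realType) (m n : nat) (hm : (1 <= m)%N) (hn : odd n) :
  parallelized_by (@frame R m n) /\ orthonormal_frame (@frame R m n).
Proof.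
have orth : orthonormal_frame (@frame R m n).
  by case=> x y [/= Sx Sy] i j; exact: inner_frame.
have tangent i z : sphere_prod z -> @frame R m n i z \in prod_tangent z.
  by case: z => x y [/= Sx Sy]; exact: frame_tangent.
split=> //; split=> [i|z Sz].
  by split; [exact: smooth_on_frame|move=> z; exact: tangent].
rewrite basisEfree orthonormal_free /=; last by move=> i j; exact: orth.
rewrite size_image card_ord dim_prod_tangent // andbT.
by apply/span_subvP => u /mapP[i _ ->]; exact: tangent.
Qed.
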